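(* Let $M \xrightarrow{R} A$ be a relative Rota-Baxter algebra and $(N \xrightarrow{S} B,l,r)$ a bimodule over it. Then $(B^*\xrightarrow{-S^*}N^*,l^*,r^* )$ is also a bimodule over $M\xrightarrow{R}A$, where $N^*$ and $B^*$ carry the dual $A$-bimodule structures and the bilinear maps $l^*:M\otimes N^*\to B^*$ and $r^*:N^*\otimes M\to B^*$ are given by $$l^*(m,f_N)(b)=f_N(r(b,m)),\qquad r^*(f_N,m)(b)=f_N(l(m,b)),\qquad m\in M,\ f_N\in N^*,\ b\in B.$$
   Context: All vector spaces and (multi)linear maps are over a field $\mathbf{k}$ of characteristic $0$. Associative algebras need not be unital. For an associative algebra $A$, an $A$-bimodule is a vector space $M$ with bilinear maps $A\otimes M\to M$, $(a,m)\mapsto a\cdot_M m$, and $M\otimes A\to M$, $(m,a)\mapsto m\cdot_M a$, with $(a\cdot a')\cdot_M m=a\cdot_M(a'\cdot_M m)$, $(a\cdot_M m)\cdot_M a'=a\cdot_M(m\cdot_M a')$, $(m\cdot_M a)\cdot_M a'=m\cdot_M(a\cdot a')$. The dual $A$-bimodule structure on the dual space $M^*$ is $(a\cdot_{M^*}f)(m)=f(m\cdot_M a)$, $(f\cdot_{M^*}a)(m)=f(a\cdot_M m)$. A relative Rota-Baxter algebra $M\xrightarrow{R}A$ consists of an associative algebra $A$, an $A$-bimodule $M$ and a linear map $R:M\to A$ with $R(m)\cdot R(m')=R(R(m)\cdot_M m'+m\cdot_M R(m'))$ for all $m,m'\in M$. A bimodule over $M\xrightarrow{R}A$ is a tuple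 $(N\xrightarrow{S}B,l,r)$ in which $S:N\to B$ is a linear map ($2$-term chain complex), $B$ and $N$ are both $A$-bimodules, and $l:M\otimes B\to N$, $r:B\otimes M\to N$ are bilinear maps such that for all $a\in A,b\in B,m\in M,n\in N$: - $l(a\cdot_M m,b)=a\cdot_N l(m,b)$, $l(m\cdot_M a,b)=l(m,a\cdot_B b)$, $l(m,b\cdot_B a)=l(m,b)\cdot_N a$; - $r(a\cdot_B b,m)=a\cdot_N r(b,m)$, $r(b\cdot_B a,m)=r(b,a\cdot_M m)$, $r(b,m\cdot_M a)=r(b,m)\cdot_N a$; - $R(m)\cdot_B S(n)=S(R(m)\cdot_N n+l(m,S(n)))$, $S(n)\cdot_B R(m)=S(r(S(n),m)+n\cdot_N R(m))$. $S^*:B^*\to N^*$ is the transpose, $S^*(f)=f\circ S$. In the claimed bimodule, $B^*$ plays the role of $N$ and $N^*$ the role of $B$. *)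

(* Defs.v *)
From HB Require Import structures.
From mathcomp Require Import all_boot all_algebra.
From mathcomp Require Import boolp.

Set Implicit Arguments.
Unset Strict Implicit.
Unset Printing Implicit Defensive.

Import GRing.Theory.
Local Open Scope ring_scope.

(* MathComp's type {scalar V} of linear forms carries no vector space
   structure; the alias [dual V] is equipped with the pointwise one (decidable
   equality and choice are classical).  No dimension is assumed finite. *)
Definition dual (k : fieldType) (V : lmodType k) : Type := {scalar V}.

Section DualSpace.
Context {k : fieldType} {V : lmodType k}.

Definition dual_form (f : V -> k) (fP : scalar f) : dual V :=
  HB.pack f (GRing.isLinear.Build k V k *%R f fP).

HB.instance Definition _ := gen_eqMixin (dual V).
HB.instance Definition _ := gen_choiceMixin (dual V).

Lemma dual_ext (f g : dual V) : (forall v, f v = g v) -> f = g.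
Proof.
move=> /funext; case: f => f [[cf] [df]]; case: g => g [[cg] [dg]] /= efg.
case: _ / efg in cg dg *.
by rewrite (Prop_irrelevance cf cg) (Prop_irrelevance df dg).
Qed.

Lemma dual_add_subproof (f g : dual V) : scalar (fun v => f v + g v).
Proof. by move=> c u v; rewrite !linearP /= mulrDr addrACA. Qed.

Lemma dual_zero_subproof : scalar (fun _ : V => 0 : k).
Proof. by move=> c u v; rewrite mulr0 addr0. Qed.

Lemma dual_opp_subproof (f : dual V) : scalar (fun v => - f v).
Proof. by move=> c u v; rewrite linearP /= opprD mulrN. Qed.

Lemma dual_scale_subproof (a : k) (f : dual V) : scalar (fun v => a * f v).
Proof. by move=> c u v; rewrite linearP /= mulrDr mulrCA. Qed.

Definition dual_zero : dual V := dual_form dual_zero_subproof.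
Definition dual_opp (f : dual V) : dual V := dual_form (dual_opp_subproof f).
Definition dual_add (f g : dual V) : dual V :=
  dual_form (dual_add_subproof f g).
Definition dual_scale (a : k) (f : dual V) : dual V :=
  dual_form (dual_scale_subproof a f).

Lemma dual_addA : associative dual_add.
Proof. by move=> f g h; apply: dual_ext => v /=; rewrite addrA. Qed.
Lemma dual_addC : commutative dual_add.
Proof. by move=> f g; apply: dual_ext => v /=; rewrite addrC. Qed.
Lemma dual_add0 : left_id dual_zero dual_add.
Proof. by move=> f; apply: dual_ext => v /=; rewrite add0r. Qed.
Lemma dual_addN : left_inverse dual_zero dual_opp dual_add.
Proof. by move=> f; apply: dual_ext => v /=; rewrite addNr. Qed.

HB.instance Definition _ :=
  GRing.isZmodule.Build (dual V) dual_addA dual_addC dual_add0 dual_addN.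

Lemma dual_scaleA (a b : k) (f : dual V) :
  dual_scale a (dual_scale b f) = dual_scale (a * b) f.
Proof. by apply: dual_ext => v /=; rewrite mulrA. Qed.
Lemma dual_scale1 : left_id 1 dual_scale.
Proof. by move=> f; apply: dual_ext => v /=; rewrite mul1r. Qed.
Lemma dual_scaleDr : right_distributive dual_scale +%R.
Proof. by move=> a f g; apply: dual_ext => v /=; rewrite mulrDr. Qed.
Lemma dual_scaleDl (f : dual V) : {morph dual_scale^~ f : a b / a + b}.
Proof. by move=> a b; apply: dual_ext => v /=; rewrite mulrDl. Qed.

HB.instance Definition _ := GRing.Zmodule_isLmodule.Build k (dual V)
  dual_scaleA dual_scale1 dual_scaleDr dual_scaleDl.

Lemma dualDE (f g : dual V) v : (f + g) v = f v + g v. Proof. by []. Qed.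
Lemma dualNE (f : dual V) v : (- f) v = - f v. Proof. by []. Qed.
Lemma dualZE a (f : dual V) v : (a *: f) v = a * f v. Proof. by []. Qed.

End DualSpace.

Section Transpose.
Context {k : fieldType} {V W : lmodType k}.

Lemma transpose_subproof (S : {linear V -> W}) (f : dual W) :
  scalar (fun v => f (S v)).
Proof. by move=> c u v; rewrite !linearP. Qed.

Definition transpose (S : {linear V -> W}) (f : dual W) : dual V :=
  dual_form (transpose_subproof S f).

Lemma transpose_is_linear (S : {linear V -> W}) : linear (transpose S).
Proof. by move=> a f g; apply: dual_ext. Qed.

HB.instance Definition _ (S : {linear V -> W}) :=
  GRing.isLinear.Build k (dual W) (dual V) *:%R (transpose S)
    (transpose_is_linear S).

End Transpose.

(* Every "dual" operation below precomposes a linear form with one of the two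
   partial maps of a bilinear map h : U x V -> W. *)
Section BilinearTranspose.
Context {k : fieldType} {U V W : lmodType k}.
Variable h : {bilinear U -> V -> W}.

Lemma transposel_subproof (v : V) (f : dual W) : scalar (fun u => f (h u v)).
Proof. by move=> c x y; rewrite linearPl linearP. Qed.

Lemma transposer_subproof (u : U) (f : dual W) : scalar (fun v => f (h u v)).
Proof. by move=> c x y; rewrite linearPr linearP. Qed.

Definition transposel (v : V) (f : dual W) : dual U :=
  dual_form (transposel_subproof v f).

Definition transposer (f : dual W) (u : U) : dual V :=
  dual_form (transposer_subproof u f).

Lemma transposel_is_bilinear : bilinear_for *:%R *:%R transposel.
Proof.
by split=> [f | v] a x y; apply: dual_ext => w //=; rewrite linearPr linearP.
Qed.

Lemma transposer_is_bilinear : bilinear_for *:%R *:%R transposer.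
Proof.
by split=> [u | f] a x y; apply: dual_ext => w //=; rewrite linearPl linearP.
Qed.

HB.instance Definition _ := bilinear_isBilinear.Build k V (dual W) (dual U)
  *:%R *:%R transposel transposel_is_bilinear.

HB.instance Definition _ := bilinear_isBilinear.Build k (dual W) U (dual V)
  *:%R *:%R transposer transposer_is_bilinear.

End BilinearTranspose.

(* MathComp's algebras are unital, hence this separate structure. *)
Record assocAlg (k : fieldType) := AssocAlg {
  alg_sort :> lmodType k;
  alg_mul : {bilinear alg_sort -> alg_sort -> alg_sort};
  alg_mulA : forall a b c : alg_sort,
    alg_mul a (alg_mul b c) = alg_mul (alg_mul a b) c
}.

Record bimodule (k : fieldType) (A : assocAlg k) := Bimodule {
  bimod_sort :> lmodType k;
  lact : {bilinear A -> bimod_sort -> bimod_sort};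
  ract : {bilinear bimod_sort -> A -> bimod_sort};
  lactA : forall (a a' : A) (m : bimod_sort),
    lact (alg_mul A a a') m = lact a (lact a' m);
  lractA : forall (a a' : A) (m : bimod_sort),
    ract (lact a m) a' = lact a (ract m a');
  ractA : forall (a a' : A) (m : bimod_sort),
    ract (ract m a) a' = ract m (alg_mul A a a')
}.

Declare Scope bimod_scope.
Delimit Scope bimod_scope with bimod.
Notation "a ** b" := (alg_mul _ a b)
  (at level 40, left associativity) : bimod_scope.
Notation "a *> m" := (lact _ a m) (at level 40, left associativity) : bimod_scope.
Notation "m <* a" := (ract _ m a) (at level 40, left associativity) : bimod_scope.
Local Open Scope bimod_scope.

Section DualBimodule.
Context {k : fieldType} {A : assocAlg k}.
Variable M : bimodule A.

(* (a *> f) m = f (m <* a) and (f <* a) m = f (a *> m) *)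
Definition dual_lact : {bilinear A -> dual M -> dual M} := transposel (ract M).
Definition dual_ract : {bilinear dual M -> A -> dual M} := transposer (lact M).

Lemma dual_lactA (a a' : A) (f : dual M) :
  dual_lact (a ** a') f = dual_lact a (dual_lact a' f).
Proof. by apply: dual_ext => m /=; rewrite ractA. Qed.

Lemma dual_lractA (a a' : A) (f : dual M) :
  dual_ract (dual_lact a f) a' = dual_lact a (dual_ract f a').
Proof. by apply: dual_ext => m /=; rewrite lractA. Qed.

Lemma dual_ractA (a a' : A) (f : dual M) :
  dual_ract (dual_ract f a) a' = dual_ract f (a ** a').
Proof. by apply: dual_ext => m /=; rewrite lactA. Qed.

Definition dual_bimodule : bimodule A :=
  Bimodule dual_lactA dual_lractA dual_ractA.

End DualBimodule.

Record relRBAlg (k : fieldType) := RelRBAlg {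
  rb_alg : assocAlg k;
  rb_mod : bimodule rb_alg;
  rb_op : {linear rb_mod -> rb_alg};
  rb_opP : forall m m' : rb_mod,
    rb_op m ** rb_op m' = rb_op (rb_op m *> m' + m <* rb_op m')
}.

Record isRelRBBimodule (k : fieldType) (X : relRBAlg k)
    (N B : bimodule (rb_alg X)) (S : {linear N -> B})
    (l : {bilinear rb_mod X -> B -> N})
    (r : {bilinear B -> rb_mod X -> N}) : Prop := IsRelRBBimodule {
  lactl : forall (a : rb_alg X) (m : rb_mod X) (b : B),
    l (a *> m) b = a *> l m b;
  lractl : forall (a : rb_alg X) (m : rb_mod X) (b : B),
    l (m <* a) b = l m (a *> b);
  ractl : forall (a : rb_alg X) (m : rb_mod X) (b : B),
    l m (b <* a) = l m b <* a;
  lactr : forall (a : rb_alg X) (b : B) (m : rb_mod X),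
    r (a *> b) m = a *> r b m;
  rlactr : forall (a : rb_alg X) (b : B) (m : rb_mod X),
    r (b <* a) m = r b (a *> m);
  ractr : forall (a : rb_alg X) (b : B) (m : rb_mod X),
    r b (m <* a) = r b m <* a;
  rb_lact : forall (m : rb_mod X) (n : N),
    rb_op X m *> S n = S (rb_op X m *> n + l m (S n));
  rb_ract : forall (m : rb_mod X) (n : N),
    S n <* rb_op X m = S (r (S n) m + n <* rb_op X m)
}.

Section DualStructureMaps.
Context {k : fieldType} {X : relRBAlg k} {N B : bimodule (rb_alg X)}.

Definition dual_l (r : {bilinear B -> rb_mod X -> N}) :
    {bilinear rb_mod X -> dual_bimodule N -> dual_bimodule B} :=
  transposel r.

Definition dual_r (l : {bilinear rb_mod X -> B -> N}) :
    {bilinear dual_bimodule N -> rb_mod X -> dual_bimodule B} :=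
  transposer l.

Lemma dual_lE (r : {bilinear B -> rb_mod X -> N}) (m : rb_mod X) (f : dual N)
  (b : B) : (dual_l r m f : dual B) b = f (r b m).
Proof. by []. Qed.

Lemma dual_rE (l : {bilinear rb_mod X -> B -> N}) (f : dual N) (m : rb_mod X)
  (b : B) : (dual_r l f m : dual B) b = f (l m b).
Proof. by []. Qed.

Definition opp_transpose (S : {linear N -> B}) :
    {linear dual_bimodule B -> dual_bimodule N} :=
  \- transpose S.

Lemma opp_transposeE (S : {linear N -> B}) (f : dual B) (n : N) :
  (opp_transpose S f : dual N) n = - f (S n).
Proof. by []. Qed.

End DualStructureMaps.

(* Main.v *)
(** Each axiom of the dual bimodule, evaluated at a vector, is an axiom of the
    original one with the roles of [l] and [r], and of left and right actions,
    exchanged.  The sign in [-S^*] enters only in the two Rota-Baxter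
    identities: there the terms with [l^*] and [r^*] contain [S^*] twice, so
    that they carry the sign opposite to that of the remaining terms. *)

Require Import Defs.
From mathcomp Require Import all_boot all_algebra.

Local Open Scope ring_scope.

Theorem proposition3p4 (k : fieldType) (char0 : [pchar k] =i pred0)
    (X : relRBAlg k) (N B : bimodule (rb_alg X)) (S : {linear N -> B})
    (l : {bilinear rb_mod X -> B -> N}) (r : {bilinear B -> rb_mod X -> N}) :
  isRelRBBimodule S l r ->
  @isRelRBBimodule k X (dual_bimodule B) (dual_bimodule N)
    (opp_transpose S) (dual_l r) (dual_r l).
Proof.
case=> l_lact l_mid l_ract r_lact r_mid r_ract S_lact S_ract.
split=> [a m f|a m f|a m f|a f m|a f m|a f m|m f|m f]; apply: dual_ext => v /=.
(* Since [a] acts on a form through its argument, the middle and outer axioms are permuted: the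
   three for [l^*] use those of [r]. *)
- by rewrite r_mid.
- by rewrite r_ract.
- by rewrite r_lact.
- by rewrite l_ract.
- by rewrite l_lact.
- by rewrite l_mid.
(* Unfolded at [v] in [N]. By [S_ract] the first term in the bracket yields a summand
   [f (S (r (S v) m))], which the second cancels. *)
- change (- f (S (ract N v (rb_op X m))) =
    - (f (ract B (S v) (rb_op X m)) + - f (S (r (S v) m)))).
  by rewrite S_ract !GRing.linearD GRing.addrAC GRing.subrr GRing.add0r.
(* The mirror case: [S_lact] produces [f (S (l m (S v)))], cancelled by the term from [r^*]. *)
- change (- f (S (lact N (rb_op X m) v)) =
    - (- f (S (l m (S v))) + f (lact B (rb_op X m) (S v)))).
  by rewrite S_lact !GRing.linearD GRing.addrC GRing.addrK.
Qed.
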